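(* Let $P^N\in\mathcal M^{np,N}$ be realizable under $(\mathcal Q_\beta,s)$. Let $Q_\beta\in\mathcal Q_\beta$ be such that $P^{F,s,N}(Q_\beta)\in\mathcal L^N(P^N)$ and let $\psi=\int_{\mathcal B}g(\beta)\,dQ_\beta(\beta)$. Then there exist $B^N\subset\mathcal B$ and $Q_\beta^N\in\mathcal Q_\beta$ such that $1\le\mathrm{Card}(B^N)\le\tilde L^N+2$, $Q_\beta^N(B^N)=1$, and $$P^{F,s,N}(Q_\beta^N)\in\mathcal L^N(P^N),\qquad\int_{\mathcal B}g(\beta)\,dQ_\beta^N(\beta)=\psi .$$
   Context: Write $[m]=\{1,\dots,m\}$. Let $J,T\ge 1$ be integers and $\mathcal A_T=\{A_1\times\cdots\times A_T: \varnothing\neq A_t\subseteq[J]\}$. For an integer $N\ge1$ fix a design $a_1^N,\dots,a_N^N\in\mathcal A_T$, let $\mathcal Y^N=a_1^N\times\cdots\times a_N^N$ and let $\mathcal M^{np,N}$ be the set of all probability measures on the finite set $\mathcal Y^N$. Let $(\mathcal B,\mathscr B)$ be a measurable space and $\mathcal Q_\beta$ the set of all probability measures on it. A choice kernel is a measurable map $s:\mathcal B\times\mathcal A_T\times[J]^T\to[0,1]$ (discrete $\sigma$-algebras on the finite factors) with $s(\beta,a,y)=0$ if $y\notin a$ and $\sum_{y\in a}s(\beta,a,y)=1$ for all $(\beta,a)$; fix one. Let $g:\mathcal B\to[0,1]$ be measurable. Let $(\mathcal Z^N,\mathscr Z^N)=\prod_{i=1}^N(\mathcal B\times a_i^N)$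 with its product $\sigma$-algebra (discrete on each $a_i^N$). For $Q_\beta\in\mathcal Q_\beta$, $P^{F,s,N}(Q_\beta)$ is the probability measure on $\mathcal Z^N$ that is the law of pairs $(\beta_i,Y_i)_{i\in[N]}$, independent across $i$, with $\beta_i\sim Q_\beta$ and $\mathbb P(Y_i=y\mid\beta_i)=s(\beta_i,a_i^N,y)$. $M_{\mathcal Y^N}$ maps a probability measure on $\mathcal Z^N$ to its marginal law of $(Y_1,\dots,Y_N)$ on $\mathcal Y^N$, so $M_{\mathcal Y^N}(P^{F,s,N}(Q_\beta))(y_1,\dots,y_N)=\prod_{i=1}^N\int_{\mathcal B} s(\beta,a_i^N,y_i)\,dQ_\beta(\beta)$. $P^N\in\mathcal M^{np,N}$ is realizable under $(\mathcal Q_\beta,s)$ if $P^N=M_{\mathcal Y^N}(P^{F,s,N}(Q_\beta))$ for some $Q_\beta\in\mathcal Q_\beta$. $\mathcal L^N(P^N)$ is the set of probability measures $R$ on $(\mathcal Z^N,\mathscr Z^N)$ with $M_{\mathcal Y^N}(R)=P^N$. Let $\mathcal D^N=\{(a,y):a\in\{a_1^N,\dots,a_N^N\},y\in a\}$, $L^N=\#\mathcal D^N$, $(a(l),y(l))_{l\in[L^N]}$ an ordering of $\mathcal D^N$, and $t_l^N(\beta)=s(\beta,a(l),y(l))$. $\tilde L^N+1$ is the maximal cardinality of a linearly independent subset of the functions $\{1,t_1^N,\dots,t^N_{L^N}\}$ on $\mathcal B$.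
   Formalization: Since a finite set B^N need not be measurable in an arbitrary measurable space, Q_β^N(B^N)=1 is read as: every measurable set containing B^N has probability 1 (outer measure 1), which is the usual meaning whenever B^N is measurable. *)

(* Defs.v *)
From HB Require Import structures.
From mathcomp Require Import all_boot all_order all_algebra finmap.
From mathcomp Require Import all_classical all_reals all_analysis.
From mathcomp Require Import measurable_realfun.

Set Implicit Arguments.
Unset Strict Implicit.
Unset Printing Implicit Defensive.

Import Order.TTheory GRing.Theory Num.Theory.
Local Open Scope classical_set_scope.
Local Open Scope ring_scope.

(* There are [J.+1] alternatives: a [measurableType] must be inhabited. *)
Definition profile (J T : nat) := {ffun 'I_T -> 'I_J.+1}.

HB.instance Definition _ J T := Finite.on (profile J T).
HB.instance Definition _ J T :=
  isPointed.Build (profile J T) [ffun=> ord0].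
HB.instance Definition _ J T := @isMeasurable.Build default_measure_display
  (profile J T) discrete_measurable discrete_measurable0
  discrete_measurableC discrete_measurableU.

(* [a = A_1 x ... x A_T] with every [A_t] nonempty. *)
Definition is_menu J T (a : {set profile J T}) :=
  [exists A : {ffun 'I_T -> {set 'I_J.+1}},
    [forall t, A t != finset.set0]
    && (a == [set y : profile J T | [forall t, y t \in A t]]%SET)].

Definition menu J T := {a : {set profile J T} | is_menu a}.

Lemma is_menuT J T : is_menu [set: profile J T]%SET.
Proof.
apply/existsP; exists [ffun=> [set: 'I_J.+1]%SET]; apply/andP; split.
  by apply/forallP => t; rewrite ffunE; apply/set0Pn; exists ord0; rewrite inE.
by apply/eqP/setP => y; rewrite !inE; apply/esym/forallP => t; rewrite ffunE inE.
Qed.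

Lemma menu_neq0 J T (a : menu J T) : exists y, y \in val a.
Proof.
case: a => a /= /existsP[A /andP[/forallP A0 /eqP ->]].
exists [ffun t => xchoose (set0Pn _ (A0 t))]; rewrite inE.
by apply/forallP => t; rewrite ffunE; exact: xchooseP.
Qed.

HB.instance Definition _ J T := Finite.on (menu J T).
HB.instance Definition _ J T :=
  isPointed.Build (menu J T) (exist _ [set: profile J T]%SET (is_menuT J T)).
HB.instance Definition _ J T := @isMeasurable.Build default_measure_display
  (menu J T) discrete_measurable discrete_measurable0
  discrete_measurableC discrete_measurableU.

Definition alt J T (a : menu J T) := {y : profile J T | y \in val a}.

HB.instance Definition _ J T (a : menu J T) := Finite.on (alt a).
HB.instance Definition _ J T (a : menu J T) :=
  isPointed.Build (alt a) (exist _ (xchoose (menu_neq0 a)) (xchooseP (menu_neq0 a))).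
HB.instance Definition _ J T (a : menu J T) :=
  @isMeasurable.Build default_measure_display
  (alt a) discrete_measurable discrete_measurable0
  discrete_measurableC discrete_measurableU.

Definition outcome J T N (a : 'I_N -> menu J T) :=
  {dffun forall i : 'I_N, alt (a i)}.

HB.instance Definition _ J T N (a : 'I_N -> menu J T) := Finite.on (outcome a).
HB.instance Definition _ J T N (a : 'I_N -> menu J T) :=
  isPointed.Build (outcome a) (finfun (fun i => point : alt (a i))).
HB.instance Definition _ J T N (a : 'I_N -> menu J T) :=
  @isMeasurable.Build default_measure_display
  (outcome a) discrete_measurable discrete_measurable0
  discrete_measurableC discrete_measurableU.

Definition fprodm d n (X : 'I_n -> measurableType d) := forall i, X i.

Definition fprodm_display : measure_display -> measure_display.
Proof. exact. Qed.

Section fprodm_measurable.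
Context d n (X : 'I_n -> measurableType d).

Definition fprodm_cylinder : set (set (fprodm X)) :=
  \bigcup_i preimage_set_system setT (fun x : fprodm X => x i) measurable.

HB.instance Definition _ := Pointed.copy (fprodm X) (forall i, X i).
HB.instance Definition _ := @isMeasurable.Build (fprodm_display d)
  (fprodm X) <<s fprodm_cylinder >>
  (@sigma_algebra0 _ setT _) (@sigma_algebraC (forall i, X i) _)
  (@sigma_algebra_bigcup _ setT _).

Lemma measurable_proj i : measurable_fun setT (fun x : fprodm X => x i).
Proof.
move=> _ A mA; apply: sub_sigma_algebra; exists i => //; exists A => //.
Qed.

Lemma measurable_fun_fprodm d' (S : measurableType d') (f : S -> fprodm X) :
  (forall i, measurable_fun setT (fun s => f s i)) -> measurable_fun setT f.
Proof.
move=> mf; apply: measurability => //.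
move=> _ [_ [i _ [A mA <-]] <-]; rewrite !setTI -comp_preimage.
by rewrite -[X in measurable X]setTI; exact: mf.
Qed.

End fprodm_measurable.

Section fcons.
Context d n (X : 'I_n.+1 -> measurableType d).

Definition fcons (p : X ord0 * fprodm (fun i : 'I_n => X (lift ord0 i))) : fprodm X :=
  fun i => match unliftP ord0 i with
    | UnliftSome j e => ecast i (X i) (esym e) (p.2 j)
    | UnliftNone e => ecast i (X i) (esym e) p.1
    end.

Lemma fcons0 p : fcons p ord0 = p.1.
Proof.
rewrite /fcons; case: unliftP => [j e|e]; first by exfalso; move: (neq_lift ord0 j); rewrite -e eqxx.
by rewrite (eq_axiomK e).
Qed.

Lemma fconsS p j : fcons p (lift ord0 j) = p.2 j.
Proof.
rewrite /fcons; case: unliftP => [k e|e]; last by exfalso; move: (neq_lift ord0 j); rewrite e eqxx.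
by have kj := lift_inj e; subst k; rewrite (eq_axiomK e).
Qed.

Lemma measurable_fcons : measurable_fun setT fcons.
Proof.
apply: measurable_fun_fprodm => i; have [j ->|->] := unliftP ord0 i.
  rewrite (_ : (fun p => _) = (fun f : fprodm _ => f j) \o snd).
    apply: measurableT_comp; first exact: measurable_proj.
    exact: measurable_snd.
  by apply/funext => p; exact: fconsS.
rewrite (_ : (fun p => _) = fst); first exact: measurable_fst.
by apply/funext => p; exact: fcons0.
Qed.

HB.instance Definition _ :=
  isMeasurableFun.Build _ _ _ _ fcons measurable_fcons.

End fcons.

(* The product of the [P i]; [fprodPE] gives its values on rectangles. *)
Fixpoint fprodP d (R : realType) n :
  forall (X : 'I_n -> measurableType d) (P : forall i, probability (X i) R),
  probability (fprodm X) R :=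
  match n with
  | 0%N => fun X P => \d_(point : fprodm X)
  | n'.+1 => fun X P =>
      distribution (P ord0 \x fprodP (fun i : 'I_n' => P (lift ord0 i)))%E (@fcons _ _ X)
  end.

Lemma fprodPE d (R : realType) n (X : 'I_n -> measurableType d)
    (P : forall i, probability (X i) R) (A : forall i, set (X i)) :
  (forall i, measurable (A i)) ->
  fprodP P [set x | forall i, A i (x i)] = (\prod_(i < n) P i (A i))%E.
Proof.
elim: n X P A => [|n IH] X P A mA.
  by rewrite big_ord0 /= diracE mem_set//= => -[].
rewrite big_ord_recl /= -IH; last by move=> i; exact: mA.
rewrite /distribution /pushforward -product_measure1E//; last first.
  rewrite [X in measurable X](_ : _ = \bigcap_i
      ((fun x : fprodm _ => x i) @^-1` A (lift ord0 i))); last first.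
    by apply/seteqP; split => x /= xA => [i _|i]; exact: xA.
  apply: fin_bigcap_measurable => // i _.
  by rewrite -[X in measurable X]setTI; apply: measurable_proj; [|exact: mA].
congr (_ _); apply/seteqP; split => -[x f] /=.
  move=> h; split => [|i]; first by have := h ord0; rewrite fcons0.
  by have := h (lift ord0 i); rewrite fconsS.
move=> [/= h1 h2] i; have [j ->|->] := unliftP ord0 i; first by rewrite fconsS.
by rewrite fcons0.
Qed.

Record choice_kernel d (B : measurableType d) (R : realType) (J T : nat) :=
  ChoiceKernel {
    choice_prob :> B -> menu J T -> profile J T -> R;
    choice_prob_measurable : measurable_fun
      [set: B * menu J T * profile J T]
      (fun z => choice_prob z.1.1 z.1.2 z.2);
    choice_prob_ge0 : forall b a y, 0 <= choice_prob b a y;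
    choice_prob_le1 : forall b a y, choice_prob b a y <= 1;
    choice_prob_out : forall b (a : menu J T) y, y \notin val a -> choice_prob b a y = 0;
    choice_prob_sum : forall b (a : menu J T), \sum_(y in val a) choice_prob b a y = 1 }.

Section agent_law.
Context d (B : measurableType d) (R : realType) (J T : nat).
Variables (s : choice_kernel B R J T) (Q : probability B R) (a : menu J T).
Local Open Scope ereal_scope.

(* The law of [(b, y)] with [b] drawn from [Q], then [y] from [s b a]. *)
Definition agent_law (A : set (B * alt a)) : \bar R :=
  \int[Q]_b \sum_(y : alt a) (s b a (val y))%:E * \d_(b, y) A.

Lemma measurable_choice_prob (y : profile J T) :
  measurable_fun [set: B] (fun b => s b a y).
Proof.
rewrite (_ : (fun b => _) =
  (fun z : B * menu J T * profile J T => s z.1.1 z.1.2 z.2) \o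
  (fun b => (b, a, y)))//.
apply: measurableT_comp; first exact: choice_prob_measurable.
by apply: measurable_fun_pair => //; exact: measurable_fun_pair.
Qed.

Lemma agent_law_integrand_ge0 (A : set (B * alt a)) b (y : alt a) :
  0 <= (s b a (val y))%:E * \d_(b, y) A.
Proof. by rewrite mule_ge0// lee_fin choice_prob_ge0. Qed.

Lemma measurable_agent_law_integrand (A : set (B * alt a)) :
  measurable A -> measurable_fun [set: B]
    (fun b => \sum_(y : alt a) (s b a (val y))%:E * \d_(b, y) A).
Proof.
move=> mA; apply: emeasurable_sum => y; apply: emeasurable_funM.
  by apply/measurable_EFinP; exact: measurable_choice_prob.
apply/measurable_EFinP; rewrite (_ : (fun b => _) = \1_A \o (pair^~ y))//.
by apply: measurableT_comp; [exact: measurable_indic|exact: pair2_measurable].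
Qed.

Let agent_law0 : agent_law set0 = 0.
Proof.
apply: integral0_eq => b _; rewrite big1// => y _.
by rewrite measure0 mule0.
Qed.

Let agent_law_ge0 A : 0 <= agent_law A.
Proof.
by apply: integral_ge0 => b _; apply: sume_ge0 => y _;
  exact: agent_law_integrand_ge0.
Qed.

Let agent_law_sigma_additive : semi_sigma_additive agent_law.
Proof.
move=> F mF tF mUF.
have -> : agent_law (\bigcup_n F n) = \sum_(n <oo) agent_law (F n).
  rewrite /agent_law -integral_nneseries//.
  - apply: eq_integral => b _; rewrite nneseries_sum; last first.
      by move=> y n _; exact: agent_law_integrand_ge0.
    apply: eq_bigr => y _; rewrite nneseriesZl//.
    by congr (_ * _); exact: measure_semi_bigcup.
  - by move=> n; exact: measurable_agent_law_integrand.
  - move=> n b _; apply: sume_ge0 => y _; exact: agent_law_integrand_ge0.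
by apply: is_cvg_nneseries => n _ _; exact: agent_law_ge0.
Qed.

HB.instance Definition _ := isMeasure.Build _ _ _ agent_law
  agent_law0 agent_law_ge0 agent_law_sigma_additive.

Let agent_lawT : agent_law setT = 1.
Proof.
rewrite /agent_law (eq_integral (cst 1)); last first.
  move=> b _; under eq_bigr do rewrite diracT mule1.
  rewrite sumEFin -(choice_prob_sum s b a).
  rewrite [in RHS](reindex_omap (fun y : alt a => val y) insub)/=; last first.
    by move=> y ya; rewrite insubT.
  congr EFin; apply: eq_bigl => y; by rewrite (valP y) valK eqxx.
by rewrite integral_cst// mul1e; exact: probability_setT.
Qed.

HB.instance Definition _ :=
  Measure_isProbability.Build _ _ _ agent_law agent_lawT.

End agent_law.
Arguments agent_law {d B R J T} s Q a.

Definition sample d (B : measurableType d) J T N (a : 'I_N -> menu J T) :=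
  fprodm (fun i : 'I_N => (B * alt (a i))%type).

Definition full_law d (B : measurableType d) (R : realType) J T N
    (s : choice_kernel B R J T) (a : 'I_N -> menu J T) (Q : probability B R) :
    probability (sample B a) R :=
  fprodP (fun i => agent_law s Q (a i)).

Section marginal.
Context d (B : measurableType d) J T N (a : 'I_N -> menu J T).

Definition choices (z : sample B a) : outcome a := finfun (fun i => (z i).2).

Lemma measurable_choices : measurable_fun setT choices.
Proof.
move=> _ A _; rewrite setTI.
have -> : choices @^-1` A = \bigcup_(y in A) \bigcap_i
    ((fun z : sample B a => z i) @^-1` (snd @^-1` [set y i])).
  apply/seteqP; split => [z /= zA|z [y Ay zy]].
    by exists (choices z) => // i _ /=; rewrite ffunE.
  rewrite /preimage/= (_ : choices z = y)//.
  by apply/ffunP => i; rewrite ffunE; exact: zy.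
apply: fin_bigcup_measurable => [|y _]; first exact: finite_finset.
apply: fin_bigcap_measurable => // i _.
rewrite -[X in measurable X]setTI; apply: measurable_proj => //.
by rewrite -[X in measurable X]setTI; exact: measurable_snd.
Qed.

HB.instance Definition _ :=
  isMeasurableFun.Build _ _ _ _ choices measurable_choices.

End marginal.

Section model.
Context d (B : measurableType d) (R : realType) (J T N : nat).
Variables (s : choice_kernel B R J T) (a : 'I_N -> menu J T).

Definition marginal (P : probability (sample B a) R) :
    probability (outcome a) R :=
  distribution P (@choices _ B J T N a).

(* [=1] compares the values on all subsets of the finite discrete space
   [outcome a]; equality of the structures would add only proof irrelevance. *)
Definition realizable (P : probability (outcome a) R) :=
  exists Q : probability B R, marginal (full_law s a Q) =1 P.

Definition latent_laws (P : probability (outcome a) R) :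
    set (probability (sample B a) R) :=
  [set S | marginal S =1 P].

Lemma marginal_full_lawE (Q : probability B R) (y : outcome a) :
  marginal (full_law s a Q) [set y] =
  (\prod_(i < N) \int[Q]_b (s b (a i) (val (y i)))%:E)%E.
Proof.
rewrite /marginal/= /distribution /pushforward.
rewrite (_ : _ @^-1` _ =
    [set z : sample B a | forall i, (snd @^-1` [set y i]) (z i)]); last first.
  apply/seteqP; split => z /=; first by move=> <- i; rewrite ffunE.
  by move=> zy; apply/ffunP => i; rewrite ffunE zy.
transitivity (\prod_(i < N) agent_law s Q (a i) (snd @^-1` [set y i]))%E.
  apply: (fprodPE (fun i => agent_law s Q (a i))) => i.
  by rewrite -[X in measurable X]setTI; exact: measurable_snd.
apply: eq_bigr => i _; apply: eq_integral => b _.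
rewrite (bigD1 (y i))//= big1 ?adde0 ?diracE ?mem_set ?mule1// => u uy.
by rewrite diracE memNset ?mule0//=; exact/eqP.
Qed.

Definition menu_items : {set menu J T * profile J T} :=
  [set p | (p.1 \in codom a) && (p.2 \in val p.1)]%SET.

Definition item_prob (l : 'I_#|menu_items|) : B -> R :=
  fun b => s b (enum_val l).1 (enum_val l).2.

Definition lin_indep (X : {fset (B -> R)}) :=
  forall c : (B -> R) -> R,
    (forall b, \sum_(f <- X) c f * f b = 0) -> forall f, f \in X -> c f = 0.

Definition item_functions : {fset (B -> R)} :=
  ((fun=> 1%R) |` [fset item_prob l | l : 'I_#|menu_items|])%fset.

Definition max_indep_card : nat :=
  \max_(X <- fpowerset item_functions | `[< lin_indep X >]) #|` X|%fset.

(* The predecessor does not truncate, see [max_indep_cardE]. *)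
Definition Ltilde : nat := max_indep_card.-1.

Lemma max_indep_cardE : max_indep_card = Ltilde.+1.
Proof.
rewrite /Ltilde prednK// /max_indep_card.
have F1 : [fset (fun=> 1%R : R) : B -> R]%fset \in fpowerset item_functions.
  by rewrite fpowersetE fsub1set fset1U1.
rewrite (big_rem _ F1)/= ifT ?cardfs1 ?leq_max//.
apply/asboolP => c c0 f; rewrite inE => /eqP ->.
by have := c0 point; rewrite big_seq_fset1 mulr1.
Qed.

End model.

(* Finite subsets of [B] need not be measurable, and [Q S] is then unconstrained
   by the axioms of a measure, hence the second clause, on the outer measure:
   every measurable set containing [S] has probability 1. The two clauses are
   equivalent if [S] is measurable, by [measurable_mu_extE]. *)
Definition carried_by d (B : measurableType d) (R : realType)
    (Q : probability B R) (S : set B) :=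
  Q S = 1%E /\ mu_ext Q S = 1%E.

(* Main.v *)
Require Import Defs.
From HB Require Import structures.
From mathcomp Require Import all_boot all_order all_algebra finmap.
From mathcomp Require Import all_classical all_reals all_analysis.
From mathcomp Require Import measurable_realfun.
From mathcomp Require Import ring lra.

Import Order.TTheory GRing.Theory Num.Theory.
Set Implicit Arguments.
Unset Strict Implicit.
Unset Printing Implicit Defensive.

Local Open Scope classical_set_scope.
Local Open Scope ring_scope.

(* A probability with finite support has the same marginal as [Q] as soon as it
   gives the same mean to every [t_l]. Choose a maximal independent family [X]
   of [1, t_1, ..., t_L], so [#|X| <= Ltilde + 1], and let [F] list the
   functions [g :: X]. The mean of a random vector lies in every convex set
   containing its values, here the cone spanned by the values of [F]; by
   Caratheodory's theorem for cones it is a nonnegative combination of at most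
   [Ltilde + 2] values [F (b_j)]. As [1] lies in the span of [X], the weights
   add up to [1]. *)

(** * Convexity in finite dimension: cones and separation *)

(** More than [n] rows are linearly dependent; moving the weights along a dependency until one of
    them vanishes removes a row and keeps the combination. *)
Lemma conic_caratheodory (R : realFieldType) p n (A : 'M[R]_(p, n))
    (w : 'rV[R]_p) :
  (forall j, 0 <= w 0 j) ->
  exists q (f : 'I_q -> 'I_p) (v : 'rV[R]_q),
    [/\ (q <= n)%N, forall j, 0 <= v 0 j & v *m rowsub f A = w *m A].
Proof.
elim: p A w => [|p IH] A w w0.
  by exists 0%N, id, w; split; rewrite // mxsub_id.
have [pn|np] := leqP p.+1 n.
  by exists p.+1, id, w; split; rewrite // mxsub_id.
have [u uA [j0 uj0]] :
    exists2 u : 'rV[R]_p.+1, u *m A = 0 & exists j, 0 < u 0 j.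
  have : kermx A != 0.
    by rewrite kermx_eq0 /row_free neq_ltn (leq_ltn_trans (rank_leq_col A) np).
  case/rowV0Pn => u /sub_kermxP uA /rV0Pn[j]; case: ltrgtP => // uj _.
    by exists (- u); [rewrite mulNmx uA oppr0|exists j; rewrite mxE oppr_gt0].
  by exists u => //; exists j.
(* The minimal ratio is the largest multiple of [u] that can be subtracted from [w] with all entries
   staying nonnegative; the entry at [j] becomes zero. *)
have [/= j uj jmin] :=
  @arg_minP _ R _ j0 (fun j => 0 < u 0 j) (fun j => w 0 j / u 0 j) uj0.
pose r := w 0 j / u 0 j.
pose v := w - r *: u.
have r0 : 0 <= r by rewrite divr_ge0// ltW.
have v0 k : 0 <= v 0 k.
  rewrite !mxE subr_ge0; have [uk|uk] := ltP 0 (u 0 k).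
    by rewrite -ler_pdivlMr//; exact: jmin.
  by apply: le_trans (w0 k); rewrite mulr_ge0_le0.
have vj : v 0 j = 0 by rewrite !mxE divfK ?subrr// gt_eqF.
have vA : v *m A = w *m A by rewrite mulmxBl -scalemxAl uA scaler0 subr0.
have [k|q [f [v' [qn v'0 v'E]]]] := IH (row' j A) (col' j v).
  by rewrite mxE; exact: v0.
exists q, (lift j \o f), v'; split => //.
have -> : rowsub (lift j \o f) A = rowsub f (row' j A).
  by apply/matrixP => a b; rewrite !mxE.
rewrite v'E -vA; apply/rowP => k; rewrite !mxE.
rewrite [RHS](bigD1_ord j)//= vj mul0r add0r.
by apply: eq_bigr => i _; rewrite !mxE.
Qed.

(* Hahn-Banach: the functional is built one coordinate at a time. *)
Lemma convex_avoid0 (R : realType) n (K : set 'rV[R]_n) :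
  (forall x y (t : R), 0 <= t <= 1 -> K x -> K y ->
    K (t *: x + (1 - t) *: y)) ->
  K !=set0 -> ~ K 0 ->
  exists2 c : 'cV[R]_n, c != 0 & forall x, K x -> 0 <= (x *m c) 0 0.
Proof.
elim: n K => [|n IH] K cK [x0 Kx0] K0.
  by exfalso; apply: K0; rewrite (_ : 0 = x0)//; apply/rowP => -[].
have [e e0 eE] : exists2 e : 'cV[R]_n.+1, e != 0 &
    forall x : 'rV_n.+1, (x *m e) 0 0 = x 0 0.
  exists (delta_mx ord0 ord0); last by move=> x; rewrite -colE mxE.
  by apply/cV0Pn; exists 0; rewrite mxE !eqxx oner_neq0.
(* If coordinate 0 does not change sign on [K], then [e] or [- e] will do; otherwise [K] has points
   strictly on both sides. *)
have [Kge0|] := pselect (forall x, K x -> 0 <= x 0 0).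
  by exists e => // x /Kge0; rewrite eE.
move=> /existsNP[xn /not_implyP[Kxn /negP]]; rewrite -ltNge => xn0.
have [Kle0|] := pselect (forall x, K x -> x 0 0 <= 0).
  exists (- e); rewrite ?oppr_eq0// => x /Kle0.
  by rewrite mulmxN mxE eE oppr_ge0.
move=> /existsNP[xp /not_implyP[Kxp /negP]]; rewrite -ltNge => xp0.
pose tl (x : 'rV[R]_n.+1) : 'rV[R]_n := col' 0 x.
pose K' : set 'rV[R]_n := [set y | exists2 x, K x /\ x 0 0 = 0 & tl x = y].
(* the point of the segment [x, y] on the hyperplane [z 0 0 = 0] *)
have K'xy x y : K x -> K y -> 0 < x 0 0 -> y 0 0 < 0 ->
    K' ((- y 0 0 / (x 0 0 - y 0 0)) *: tl x +
        (x 0 0 / (x 0 0 - y 0 0)) *: tl y).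
  move=> Kx Ky x_gt0 y_lt0; set t := - y 0 0 / _.
  have D0 : 0 < x 0 0 - y 0 0 by lra.
  have tE : 1 - t = x 0 0 / (x 0 0 - y 0 0) by rewrite /t; field; lra.
  have t01 : 0 <= t <= 1.
    by rewrite divr_ge0//= ?ler_pdivrMr//; lra.
  exists (t *: x + (1 - t) *: y).
    split; first exact: cK.
    by rewrite !mxE tE /t; field; lra.
  by rewrite /tl; apply/rowP => i; rewrite !mxE tE.
have [||| c' c'0 c'K] := IH K'.
- move=> _ _ t t01 [x [Kx x_0] <-] [y [Ky y_0] <-].
  exists (t *: x + (1 - t) *: y).
    by split; [exact: cK|rewrite !mxE x_0 y_0 !mulr0 addr0].
  by apply/rowP => i; rewrite !mxE.
- by eexists; exact: (K'xy xp xn).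
- move=> [x [Kx x_0] xtl]; apply: K0; rewrite (_ : 0 = x)//.
  apply/rowP => i; rewrite mxE.
  have [j ->|->] := unliftP 0 i; last by rewrite x_0.
  by move/rowP/(_ j) : xtl; rewrite !mxE.
(* Sought is a number [r] with [0 <= x 0 0 * r + h x] on [K]. Points with [0 < x 0 0] bound [r]
   below by the elements of [E], those with [x 0 0 < 0] bound it above; [sup E] meets both
   demands. *)
pose h x := (tl x *m c') 0 0.
pose E := [set - h x / x 0 0 | x in [set x | K x /\ 0 < x 0 0]].
have Eub y : K y -> y 0 0 < 0 -> ubound E (- h y / y 0 0).
  move=> Ky y_lt0 _ [x [Kx x_gt0] <-].
  (* At the crossing point of the segment, nonnegativity of [c'] says that the lower bound from [x]
     is at most the upper bound from [y]. *)
  have := c'K _ (K'xy _ _ Kx Ky x_gt0 y_lt0).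
  rewrite mulmxDl -!scalemxAl [X in _ <= X]mxE [X in X + _]mxE [X in _ + X]mxE.
  rewrite -/(h x) -/(h y) => hxy.
  have D0 : 0 < x 0 0 - y 0 0 by lra.
  rewrite ler_pdivrMr// mulrAC ler_ndivlMr//.
  have : 0 <= (- y 0 0 * h x + x 0 0 * h y) / (x 0 0 - y 0 0).
    by move: hxy; congr (_ <= _); ring.
  by rewrite pmulr_lge0 ?invr_gt0//; lra.
have Esup : has_sup E.
  split; first by eexists; exists xp.
  by eexists; exact: Eub Kxn xn0.
exists (\col_i oapp (c'^~ 0) (sup E) (unlift 0 i)).
  have /cV0Pn[i ci] := c'0; apply/cV0Pn; exists (lift 0 i).
  by rewrite mxE liftK.
move=> x Kx.
have -> : (x *m \col_i oapp (c'^~ 0) (sup E) (unlift 0 i)) 0 0 =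
    x 0 0 * sup E + h x.
  rewrite /h !mxE (bigD1_ord 0)//= !mxE unlift_none/=; congr (_ + _).
  by apply: eq_bigr => i _; rewrite !mxE liftK.
have [x_lt0|x_gt0|x_0] := ltgtP (x 0 0) 0.
- have := ge_sup Esup.1 (Eub _ Kx x_lt0).
  by rewrite ler_ndivlMr//; lra.
- have /(ub_le_sup Esup.2) : E (- h x / x 0 0) by exists x.
  by rewrite ler_pdivrMr//; lra.
- by rewrite x_0 mul0r add0r; apply: c'K; exists x.
Qed.

(** * Means of random vectors *)

Lemma Rintegral_sum d (T : measurableType d) (R : realType)
    (mu : {measure set T -> \bar R}) (D : set T) I (r : seq I) (P : pred I)
    (f : I -> T -> R) :
  measurable D -> (forall i, P i -> mu.-integrable D (EFin \o f i)) ->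
  \int[mu]_(x in D) (\sum_(i <- r | P i) f i x) =
  \sum_(i <- r | P i) \int[mu]_(x in D) f i x.
Proof.
move=> mD intf; elim: r => [|i r IH].
  rewrite big_nil; under eq_Rintegral do rewrite big_nil.
  by rewrite Rintegral_cst// mul0r.
rewrite big_cons; under eq_Rintegral do rewrite big_cons.
case: ifPn => Pi //; rewrite RintegralD//; first by rewrite IH.
- exact: intf.
- rewrite (_ : _ \o _ = fun x => \sum_(i <- r | P i) (f i x)%:E)%E.
    by apply: integrable_sum => // j Pj; exact: intf.
  by apply/funext => x; rewrite /= sumEFin.
Qed.

(* By induction on [n]: if the mean [m] were not in [K], some nonzero
   functional would be nonnegative on [K - m]; it has mean zero along [F - m],
   so it vanishes almost everywhere there and determines one coordinate by the
   others. *)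
Lemma mean_in_convex (R : realType) d (B : measurableType d)
    (Q : probability B R) n (K : set 'rV[R]_n) (F : B -> 'rV[R]_n) :
  (forall x y (t : R), 0 <= t <= 1 -> K x -> K y ->
    K (t *: x + (1 - t) *: y)) ->
  (forall i, Q.-integrable setT (EFin \o (fun b => F b 0 i))) ->
  {ae Q, forall b, K (F b)} ->
  K (\row_i \int[Q]_b F b 0 i).
Proof.
(* A set of full measure is nonempty, so [K] contains some [F b0]; in dimension 0 this is already
   the claim. *)
have Q_proper : ProperFilter (almost_everywhere Q).
  have Q_gt0 : (0 < Q setT)%E by rewrite probability_setT.
  exact: ae_properfilter_algebraOfSetsType.
elim: n K F => [|n IH] K F cK intF aeK;
  have [b0 Kb0] := @filter_ex _ _ Q_proper _ aeK.
  by rewrite (_ : \row_i _ = F b0)//; apply/rowP => -[].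
set m := \row_i _; apply: contrapT => Km.
have [|||c c0 cge0] := @convex_avoid0 _ _ [set x | K (x + m)].
- move=> x y t t01 /= Kx Ky.
  rewrite [X in K X](_ : _ = t *: (x + m) + (1 - t) *: (y + m)).
    exact: cK.
  by rewrite !scalerDr addrACA -[in RHS]scalerDl [t + _]addrC subrK scale1r.
- by exists (F b0 - m); rewrite /= subrK.
- by rewrite /= add0r.
pose f b := ((F b - m) *m c) 0 0.
have fE : f = fun b => \sum_i (F b 0 i - m 0 i) * c i 0.
  by apply/funext => b; rewrite /f mxE; apply: eq_bigr => i _; rewrite !mxE.
have intFi i : Q.-integrable setT (EFin \o (fun b => F b 0 i - m 0 i)).
  apply: (@integrableB _ _ _ Q setT _ (EFin \o (fun b => F b 0 i))
    (cst (m 0 i)%:E)) => //.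
  exact: finite_measure_integrable_cst.
have intFic i :
    Q.-integrable setT (EFin \o (fun b => (F b 0 i - m 0 i) * c i 0)).
  rewrite (_ : _ \o _ = 
      fun b => (F b 0 i - m 0 i)%:E * (c i 0)%:E)%E.
    by apply: integrableZr => //; exact: intFi.
  by apply/funext => b; rewrite /= EFinM.
have f_int : Q.-integrable setT (EFin \o f).
  rewrite (_ : _ \o _ = fun b => \sum_i ((F b 0 i - m 0 i) * c i 0)%:E)%E.
    by apply: integrable_sum => // i _; exact: intFic.
  by apply/funext => b; rewrite /= fE sumEFin.
have mf := measurable_int _ f_int.
have f_mean0 : (\int[Q]_b (f b)%:E = 0)%E.
  rewrite -[LHS]fineK; last exact: integrable_fin_num.
  congr EFin; rewrite -/(Rintegral _ _ _) fE Rintegral_sum//.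
  apply: big1 => i _.
  rewrite RintegralZr// RintegralB//; last exact: finite_measure_integrable_cst.
  have QT : fine (Q setT) = 1 by rewrite probability_setT.
  rewrite mxE [X in _ - X]Rintegral_cst// [X in _ - _ * X]QT.
  by rewrite mulr1 subrr mul0r.
have f_ge0 : {ae Q, forall b, 0 <= f b}.
  by apply: filterS aeK => b Kb; apply: cge0; rewrite /= subrK.
have f_eq0 : {ae Q, forall b, f b = 0}.
  have /(ae_eq_integral_abs Q measurableT mf) :
      (\int[Q]_b `|(EFin \o f) b| = 0)%E.
    rewrite -f_mean0; apply: ae_eq_integral => //.
      exact: measurableT_comp.
    by apply: filterS f_ge0 => b fb _ /=; rewrite ger0_norm.
  by apply: filterS => b /(_ I)[].
have /cV0Pn[i ci0] := c0.
(* On the hyperplane through [m] cut out by [c], coordinate [i] is a function of the others since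
   [c i 0 != 0]; the induction runs on the projected slice. *)
pose K' : set 'rV[R]_n :=
  [set y | exists2 x, K x /\ ((x - m) *m c) 0 0 = 0 & col' i x = y].
have [|j||x [Kx xm] xi] := IH K' (fun b => col' i (F b)).
- move=> _ _ t t01 [x [Kx xm] <-] [y [Ky ym] <-].
  exists (t *: x + (1 - t) *: y); last by apply/rowP => j; rewrite !mxE.
  split; first exact: cK.
  have -> : t *: x + (1 - t) *: y - m = t *: (x - m) + (1 - t) *: (y - m).
    by rewrite !scalerBr addrACA -opprD -scalerDl [t + _]addrC subrK scale1r.
  rewrite mulmxDl -!scalemxAl [LHS]mxE [X in X + _]mxE [X in _ + X]mxE xm ym.
  by rewrite !mulr0 addr0.
- rewrite [X in _.-integrable _ X](_ : _ =
    EFin \o (fun b => F b 0 (lift i j)))//.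
  by apply/funext => b; rewrite /= mxE.
- by apply: filterS2 aeK f_eq0 => b Kb fb; exists (F b).
have xj j : x 0 (lift i j) = m 0 (lift i j).
  move/rowP/(_ j) : xi; rewrite !mxE => ->.
  by apply: eq_Rintegral => b _; rewrite mxE.
apply: Km; rewrite (_ : m = x)//; apply/rowP => j.
have [k ->|->] := unliftP i j; first by rewrite xj.
move: xm; rewrite mxE (bigD1_ord i)//= big1 => [|k _]; last first.
  by rewrite !mxE xj !mxE subrr mul0r.
rewrite addr0 => /eqP; rewrite mulf_eq0 (negbTE ci0) orbF !mxE subr_eq0.
by move=> /eqP ->.
Qed.

(** * Quadrature with few nodes *)

(** The cone spanned by the values is used instead of their convex hull: the total weight is left
    free, and the bound is the number of functions, without an extra node. *)
Lemma finite_quadrature (R : realType) d (B : measurableType d)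
    (Q : probability B R) (hs : seq (B -> R)) :
  (forall h, h \in hs -> Q.-integrable setT (EFin \o h)) ->
  exists p (b : 'I_p -> B) (w : 'I_p -> R),
    [/\ (p <= size hs)%N, forall j, 0 <= w j &
        forall h, h \in hs -> \sum_(j < p) w j * h (b j) = \int[Q]_x h x].
Proof.
move=> inth; pose F b := \row_(i < size hs) hs`_i b.
pose K := [set x : 'rV[R]_(size hs) | exists p (b : 'I_p -> B) (w : 'rV[R]_p),
  (forall j, 0 <= w 0 j) /\ x = w *m \matrix_j F (b j)].
have [|i||] := @mean_in_convex _ _ _ Q _ K F.
- move=> _ _ t /andP[t0 t1] [p [b [w [w0 ->]]]] [q [c [v [v0 ->]]]].
  exists (p + q)%N, (fun j : 'I_(p + q) =>
    match fintype.split j with inl j => b j | inr j => c j end).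
  exists (row_mx (t *: w) ((1 - t) *: v)); split.
    move=> j; rewrite mxE.
    by case: fintype.split => k; rewrite mxE mulr_ge0// subr_ge0.
  rewrite !scalemxAl -mul_row_col; congr (_ *m _).
  apply/matrixP => i j; rewrite !mxE; by case: fintype.split => k; rewrite !mxE.
- rewrite (_ : _ \o _ = EFin \o hs`_i); first by apply: inth; rewrite mem_nth.
  by apply/funext => b; rewrite /= mxE.
- apply: aeW => b; exists 1%N, (cst b), 1%:M; split.
    by move=> j; rewrite !mxE; case: eqP.
  by rewrite mul1mx; apply/matrixP => i j; rewrite !mxE ord1.
(* Here [p] is not bounded; Caratheodory's theorem cuts it down to [size hs]. *)
move=> p [b [w [w0 /esym wE]]].
have [q [f [v [qn v0 vE]]]] :=
  conic_caratheodory (\matrix_j F (b j)) w0.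
exists q, (b \o f), (v 0); split => // h /[dup] h_hs.
rewrite -index_mem => hn; pose i := Ordinal hn.
have hE : hs`_i = h by exact: nth_index.
move/rowP/(_ i) : (vE); rewrite wE !mxE.
have -> : \int[Q]_b F b 0 i = \int[Q]_b h b.
  by apply: eq_Rintegral => x _; rewrite mxE hE.
by move=> <-; apply: eq_bigr => j _; rewrite !mxE hE.
Qed.

(** * Linear independence of functions *)

(** An independent subfamily of maximal cardinality spans: adjoining any other member creates a
    relation that can be solved for it. *)
Lemma indep_span (R : realType) d (B : measurableType d) (Y : {fset (B -> R)}) :
  exists X : {fset (B -> R)}, [/\ (X `<=` Y)%fset, lin_indep X &
    forall f, f \in Y ->
      exists c : (B -> R) -> R, forall b, f b = \sum_(h <- X) c h * h b].
Proof.
pose good k :=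
  has (fun X => `[< lin_indep X >] && (#|` X|%fset == k)) (fpowerset Y).
have good0 : exists k, good k.
  exists 0%N; apply/hasP; exists fset0; first by rewrite fpowersetE fsub0set.
  by rewrite cardfs0 eqxx andbT; apply/asboolP => c _ f; rewrite inE.
have goodM k : good k -> (k <= #|` Y|%fset)%N.
  move=> /hasP[X]; rewrite fpowersetE => XY /andP[_ /eqP <-].
  exact: fsubset_leq_card.
case: (ex_maxnP good0 goodM) => k /hasP[X]; rewrite fpowersetE => XY.
move=> /andP[/asboolP Xindep /eqP Xk] kmax; exists X; split => // f fY.
have [fX|fX] := boolP (f \in X).
  exists (fun h => (h == f)%:R) => b.
  rewrite (big_fsetD1 f fX)/= eqxx mul1r big_seq big1 ?addr0// => h.
  by rewrite !inE => /andP[/negbTE -> _]; rewrite mul0r.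
have /existsNP[c /not_implyP[c0]] : ~ lin_indep (f |` X)%fset.
  move=> fXindep; have := kmax k.+1; rewrite ltnn => H.
  suff : false by []; apply: H; apply/hasP; exists (f |` X)%fset.
    by rewrite fpowersetE fsubUset fsub1set fY.
  by rewrite cardfsU1 fX Xk add1n eqxx andbT; apply/asboolP.
have {}c0 b : c f * f b + \sum_(h <- X) c h * h b = 0.
  by have := c0 b; rewrite big_fsetU1.
move=> /existsNP[h /not_implyP[]]; rewrite inE => hfX ch.
(* With [c f = 0] the relation would involve [X] only, hence be trivial. *)
have cf : c f != 0.
  apply/eqP => cf; apply: ch; move: hfX; rewrite inE => /orP[/eqP ->//|].
  by apply: Xindep => b; rewrite -[RHS](c0 b) cf mul0r add0r.
exists (fun h => - c h / c f) => b.
apply: (mulfI cf); have /eqP := c0 b; rewrite addr_eq0 => /eqP ->.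
rewrite mulr_sumr -sumrN; apply: eq_bigr => h' _.
by field.
Qed.

(** * Finitely supported probabilities *)

(** The formula for [Q A] covers every set [A], measurable or not, as finite sets of nodes may fail
    to be measurable. *)
Lemma finite_mixture (R : realType) d (B : measurableType d) p (b : 'I_p -> B)
    (w : 'I_p -> R) :
  (forall j, 0 <= w j) -> \sum_(j < p) w j = 1 ->
  exists Q : probability B R,
    (forall A, Q A = \sum_(j < p) (w j)%:E * \d_(b j) A)%E /\
    (forall f : B -> R, measurable_fun setT f -> (forall x, 0 <= f x) ->
      (\int[Q]_x (f x)%:E = (\sum_(j < p) w j * f (b j))%:E)%E).
Proof.
move=> w0 w1.
(* [msum] takes a sequence of measures; [mzero] is a default for [k >= p], where the sum does not
   reach. *)
pose m (k : nat) : {measure set B -> \bar R} := 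
  if insub k is Some j then mscale (NngNum (w0 j)) \d_(b j) else mzero.
pose mu := msum m p.
have mE (j : 'I_p) : m j = mscale (NngNum (w0 j)) \d_(b j) by rewrite /m valK.
have muE A : (mu A = \sum_(j < p) (w j)%:E * \d_(b j) A)%E.
  by apply: eq_bigr => j _; rewrite mE.
have mu1 : mu setT = 1%E.
  rewrite muE -[RHS](congr1 EFin w1) -sumEFin; apply: eq_bigr => j _.
  by rewrite diracT mule1.
pose Q : probability B R := HB.pack (msum m p)
  (Measure_isProbability.Build _ _ _ mu mu1).
exists Q; split => // f mf f0.
rewrite [LHS](_ : _ = \int[mu]_x (f x)%:E)%E//.
have mEf : measurable_fun setT (EFin \o f) by exact/measurable_EFinP.
rewrite ge0_integral_measure_sum//; last by move=> x _; rewrite lee_fin.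
rewrite -sumEFin; apply: eq_bigr => j _; rewrite mE.
rewrite ge0_integral_mscale//; last by move=> x _; rewrite lee_fin.
by rewrite integral_dirac// diracT mul1e.
Qed.

Lemma eq_measure_set1 (R : realType) d (T : measurableType d)
    (mu nu : {measure set T -> \bar R}) :
  finite_set [set: T] -> (forall A : set T, measurable A) ->
  (forall x, mu [set x] = nu [set x]) -> mu =1 nu.
Proof.
move=> finT mT eq1 A.
have -> : A = \bigcup_(x in A) [set x] by rewrite bigcup_imset1 image_id.
have finA : finite_set A by apply: sub_finite_set finT.
have tA : trivIset A set1 by move=> x y _ _ [z [-> ->]].
by rewrite !measure_fin_bigcup//; apply: eq_fsbigr => x _; exact: eq1.
Qed.

(** The union of a countable measurable cover of [S] has probability 1, so subadditivity bounds the
    outer measure below by 1. *)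
Lemma carried_by_superset1 (R : realType) d (B : measurableType d)
    (Q : probability B R) (S : set B) :
  (forall A, S `<=` A -> Q A = 1%E) -> carried_by Q S.
Proof.
move=> QS; split; first exact: QS.
apply/eqP; rewrite eq_le; apply/andP; split.
  have <- : mu_ext Q setT = 1%E by rewrite measurable_mu_extE//; exact: QS.
  exact: le_mu_ext.
apply: le_ereal_inf_tmp => _ [F [mF SF] <-].
rewrite -[leLHS](QS _ SF); apply: measure_sigma_subadditive => //.
exact: bigcup_measurable.
Qed.

(** * Choice probabilities and the reduction of the support *)

Lemma item_functions_prob d (B : measurableType d) (R : realType) (J T N : nat)
    (s : choice_kernel B R J T) (a : 'I_N -> menu J T) (i : 'I_N)
    (y : alt (a i)) :
  (fun b => s b (a i) (val y)) \in item_functions s a.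
Proof.
have ay : (a i, val y) \in menu_items a.
  by rewrite inE /= codom_f; exact: (valP y).
rewrite in_fset1U; apply/orP; right; apply/imfsetP => /=.
exists (enum_rank_in ay (a i, val y)) => //.
by apply/funext => b; rewrite /item_prob enum_rankK_in.
Qed.

Lemma item_functionsP d (B : measurableType d) (R : realType) (J T N : nat)
    (s : choice_kernel B R J T) (a : 'I_N -> menu J T) (h : B -> R) :
  h \in item_functions s a ->
  measurable_fun setT h /\ forall b, 0 <= h b <= 1.
Proof.
rewrite in_fset1U => /orP[/eqP ->|/imfsetP[/= l _ ->]].
  by split => [|b]; rewrite ?ler01 ?lexx.
split => [|b]; first exact: measurable_choice_prob.
by rewrite choice_prob_ge0 choice_prob_le1.
Qed.

Lemma integrable01 (R : realType) d (B : measurableType d)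
    (Q : probability B R) (h : B -> R) :
  measurable_fun setT h -> (forall b, 0 <= h b <= 1) ->
  Q.-integrable setT (EFin \o h).
Proof.
move=> mh h01; apply: measurable_bounded_integrable => //.
  by rewrite ltey_eq fin_num_measure.
exists 1; split => // M M1 b _ /=.
by have /andP[h0 h1] := h01 b; rewrite ger0_norm// (le_trans h1)// ltW.
Qed.

Theorem lemma20 (R : realType) (d : measure_display) (B : measurableType d)
    (J T N : nat) (T_gt0 : (0 < T)%N) (N_gt0 : (0 < N)%N)
    (a : 'I_N -> menu J T) (s : choice_kernel B R J T)
    (g : B -> R) (g_measurable : measurable_fun setT g)
    (g_01 : forall b, 0 <= g b <= 1)
    (P : probability (outcome a) R) (P_realizable : realizable s P)
    (Q : probability B R) (PQ : latent_laws P (full_law s a Q))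
    (psi : R) (psiE : (\int[Q]_b (g b)%:E = psi%:E)%E) :
  exists (BN : {fset B}) (QN : probability B R),
    [/\ (1 <= #|` BN|%fset <= Ltilde s a + 2)%N,
        carried_by QN [set` BN],
        latent_laws P (full_law s a QN) &
        (\int[QN]_b (g b)%:E = psi%:E)%E].
Proof.
have [X [XY Xindep Xspan]] := indep_span (item_functions s a).
have XL : (#|` X|%fset <= (Ltilde s a).+1)%N.
  rewrite -max_indep_cardE; apply: leq_bigmax_seq; last exact/asboolP.
  by rewrite fpowersetE.
(* Listing [g] along with [X] preserves [psi] and costs one more node. *)
have gX01 h : h \in g :: X -> measurable_fun setT h /\ forall b, 0 <= h b <= 1.
  rewrite inE => /orP[/eqP ->//|hX].
  by apply: item_functionsP (fsubsetP XY _ hX).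
have intX h : h \in g :: X -> Q.-integrable setT (EFin \o h).
  by move=> /gX01[]; exact: integrable01.
have [p [b [w [pX w0 wE]]]] := finite_quadrature intX.
(* Equality of means extends by linearity from [X] to its span. *)
have wE_item f : f \in item_functions s a ->
    \sum_(j < p) w j * f (b j) = \int[Q]_x f x.
  move=> /Xspan[c cE]; under eq_Rintegral do rewrite cE big_seq.
  rewrite Rintegral_sum//; last first.
    move=> h hX; rewrite (_ : _ \o _ = fun x => (c h)%:E * (h x)%:E)%E.
      by apply: integrableZl => //; apply: intX; rewrite inE hX orbT.
    by apply/funext => x; rewrite /= EFinM.
  under eq_bigr do rewrite cE mulr_sumr.
  rewrite exchange_big/= big_seq; apply: eq_bigr => h hX.
  have hgX : h \in g :: X by rewrite inE hX orbT.
  rewrite RintegralZl//; last exact: intX.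
  rewrite -wE// mulr_sumr; apply: eq_bigr => j _.
  by rewrite mulrCA.
have w1 : \sum_(j < p) w j = 1.
  have := wE_item _ (fset1U1 (fun=> 1) _).
  under eq_bigr do rewrite mulr1.
  move=> ->; have QT : fine (Q setT) = 1 by rewrite probability_setT.
  by rewrite Rintegral_cst// mul1r.
have [QN [QNE QN_int]] := finite_mixture b w0 w1.
have QN_mean (h : B -> R) :
    measurable_fun setT h -> (forall x, 0 <= h x <= 1) ->
    \sum_(j < p) w j * h (b j) = \int[Q]_x h x ->
    (\int[QN]_x (h x)%:E = \int[Q]_x (h x)%:E)%E.
  move=> mh h01 hE; rewrite QN_int// ?hE; last by move=> x; case/andP: (h01 x).
  by rewrite fineK//; apply: integrable_fin_num => //; exact: integrable01.
exists [fset b j | j : 'I_p]%fset, QN; split.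
- apply/andP; split.
    rewrite cardfs_gt0; apply/fset0Pn.
    have [j _] : exists j : 'I_p, true.
      apply: contrapT => noj; have := oner_neq0 R.
      rewrite -w1 big1 ?eqxx// => j.
      by case: noj; exists j.
    by exists (b j); apply/imfsetP; exists j.
  (* The nodes may repeat, so [p] only bounds the cardinality from above. *)
  rewrite (leq_trans (leq_imfset_card _ _ _))//= -cardE card_ord.
  by rewrite (leq_trans pX)// addn2 ltnS.
- apply: carried_by_superset1 => A bA.
  rewrite QNE -[RHS](congr1 EFin w1) -sumEFin.
  apply: eq_bigr => j _; rewrite diracE mem_set ?mule1//.
  by apply: bA => /=; apply/imfsetP; exists j.
(* It suffices to compare singletons, where both marginals are products of means of item
   functions. *)
- move=> A; rewrite -PQ; move: A.
  apply: (@eq_measure_set1 _ _ _ (marginal (full_law s a QN))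
    (marginal (full_law s a Q))) => [|//|y]; first exact: finite_finset.
  rewrite [LHS]marginal_full_lawE [RHS]marginal_full_lawE.
  apply: eq_bigr => i _; have y_item := item_functions_prob s (y i).
  have [my y01] := item_functionsP y_item.
  by apply: QN_mean => //; exact: wE_item.
- by rewrite -psiE QN_mean// wE// mem_head.
Qed.
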